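(* A conditional relation $R$ is a conditional bisimulation up-to context if and only if its closure under contextualization $u(R)$ is a conditional bisimulation.
   Context: Composition of $f\colon A\to B$, $g\colon B\to C$ is written $f;g$. Fix a category $\mathbf C$ with distinguished object $0$ and a representative class $\kappa$ of commuting squares: for every commuting square $\alpha_1;\delta_1=\alpha_2;\delta_2$ there are $(\alpha_1,\alpha_2,\beta_1,\beta_2)\in\kappa$ (a commuting square) and $\gamma$ with $\delta_1=\beta_1;\gamma$, $\delta_2=\beta_2;\gamma$; $\kappa(\alpha_1,\alpha_2)$ is the set of $(\beta_1,\beta_2)$ with $(\alpha_1,\alpha_2,\beta_1,\beta_2)\in\kappa$. Conditions over $A$ are defined inductively as $(A,\mathcal Q,S)$, $\mathcal Q\in\{\forall,\exists\}$, $S$ a finite set of pairs $(h,\mathcal A')$ with $h\colon A\to A'$, $\mathcal A'$ a condition over $A'$. For $a\colon A\to B$: $a\models(A,\forall,S)$ iff for all $(h,\mathcal A')\in S$ and all $g$ with $a=h;g$, $g\models\mathcal A'$; $a\models(A,\exists,S)$ iff some $(h,\mathcal A')\in S$ and $g$ satisfy $a=h;g$, $g\models\mathcal A'$. $\mathcal A\models\mathcal B$: every arrow satisfying $\mathcal A$ satisfies $\mathcal B$. Boolean connectives have the standard semantics. Shift along $c\colon A\to B$: $(A,\mathcal Q,S)_{\downarrow c}=(B,\mathcal Q,\{(\beta,\mathcal A'_{\downarrow\alpha})\mid(h,\mathcal A')\in S,(\alpha,\beta)\in\kappa(h,c)\})$; it satisfies $c;d\models\mathcal A\iff d\models\mathcal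 A_{\downarrow c}$. A conditional reactive system is a set $\mathcal S$ of rules $(\ell,r,\mathcal R)$, $\ell,r\colon0\to I$, $\mathcal R$ a condition over $I$. Context step $a\xrightarrow[C]{f,\ \mathcal A}a'$ ($a\colon0\to J$, $f\colon J\to K$, $a'\colon0\to K$, $\mathcal A$ over $K$): there are a rule $(\ell,r,\mathcal R)\in\mathcal S$ and $c\colon I\to K$ with $a;f=\ell;c$, $a'=r;c$, $\mathcal A\models\mathcal R_{\downarrow c}$. A conditional relation is a set of triples $(a,b,\mathcal C)$, $a,b\colon0\to J$, $\mathcal C$ a condition over $J$. $\mathcal D\models\bigvee_{i\in I}\mathcal E_i$ (possibly infinite $I$): every arrow satisfying $\mathcal D$ satisfies some $\mathcal E_i$. $u(R)=\{(a;d,\ b;d,\ \mathcal C_{\downarrow d})\mid(a,b,\mathcal C)\in R,\ a,b\colon0\to J,\ d\colon J\to K\}$. A conditional bisimulation is a conditional relation $R$ such that for each $(a,b,\mathcal C)\in R$ and each context step $a\xrightarrow[C]{f,\ \mathcal A}a'$ there are an index set $I$, context steps $b\xrightarrow[C]{f,\ \mathcal B_i}b'_i$ and conditions $\mathcal C'_i$ with $(a',b'_i,\mathcal C'_i)\in R$ and $\mathcal A\land\mathcal C_{\downarrow f}\models\bigvee_{i\in I}(\mathcal C'_i\land\mathcal B_i)$, and symmetrically for context steps of $b$. A conditional bisimulation up-to context is a conditional relation $R$ such that for each $(a,b,\mathcal C)\in R$ and each context step $a\xrightarrow[C]{f,\ \mathcal A}a'$ there are an index set $I$, context steps $b\xrightarrow[C]{f,\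 \mathcal B_i}b'_i$, and for each $i\in I$ a triple $(a''_i,b''_i,\mathcal C''_i)\in R$ and an arrow $j_i$ with $a'=a''_i;j_i$, $b'_i=b''_i;j_i$, such that $\mathcal A\land\mathcal C_{\downarrow f}\models\bigvee_{i\in I}((\mathcal C''_i)_{\downarrow j_i}\land\mathcal B_i)$; and symmetrically for context steps of $b$ answered by context steps of $a$. *)

(* Defs.v *)
From Stdlib Require Import List.

Set Implicit Arguments.
Unset Strict Implicit.
Unset Printing Implicit Defensive.

Record category := Category {
  obj :> Type;
  hom : obj -> obj -> Type;
  idc : forall A, hom A A;
  comp : forall A B C, hom A B -> hom B C -> hom A C;
  comp1f : forall A B (f : hom A B), comp (idc A) f = f;
  compf1 : forall A B (f : hom A B), comp f (idc B) = f;
  compA : forall A B C D (f : hom A B) (g : hom B C) (h : hom C D),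
    comp (comp f g) h = comp f (comp g h)
}.

Arguments hom {c} _ _.
Arguments idc {c} A.
Arguments comp {c A B C} _ _.

(* Diagrammatic order: first [f], then [g]. *)
Notation "f ;; g" := (comp f g) (at level 40, left associativity).

Record cospan (C : category) (B1 B2 : C) := Cospan {
  tip : C;
  leg1 : hom B1 tip;
  leg2 : hom B2 tip
}.

Arguments Cospan {C B1 B2 tip} leg1 leg2.

(* [kappa a1 a2] enumerates the finite set of all (b1, b2) such that
   (a1, a2, b1, b2) is a representative square.  Finiteness is what makes the
   shift of a condition (which has finitely many branches) a condition again. *)
Record representative_class (C : category) := RepresentativeClass {
  kappa : forall (A B1 B2 : C), hom A B1 -> hom A B2 -> list (cospan B1 B2);
  kappa_commute : forall (A B1 B2 : C) (a1 : hom A B1) (a2 : hom A B2) s,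
    In s (kappa a1 a2) -> a1 ;; leg1 s = a2 ;; leg2 s;
  kappa_represent : forall (A B1 B2 D : C) (a1 : hom A B1) (a2 : hom A B2)
      (d1 : hom B1 D) (d2 : hom B2 D),
    a1 ;; d1 = a2 ;; d2 ->
    exists s, In s (kappa a1 a2) /\
      exists g : hom (tip s) D, d1 = leg1 s ;; g /\ d2 = leg2 s ;; g
}.

Inductive quantifier := Qforall | Qexists.

(* The finite set of pairs (h, A') is given by a list; order and multiplicity
   are irrelevant for satisfaction. *)
Inductive cond (C : category) (A : C) : Type :=
  Cond (q : quantifier) (bs : list {A' : C & (hom A A' * cond A')%type}).

Arguments Cond {C A} q bs.

Definition branch (C : category) (A : C) := {A' : C & (hom A A' * cond A')%type}.

Definition Branch (C : category) (A A' : C) (h : hom A A') (c : cond A') :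
  branch A := existT _ A' (h, c).

(* The folds (rather than [Forall], [Exists]) are there for the guard condition;
   see [satisfies_forall] and [satisfies_exists] for the intended reading. *)
Fixpoint satisfies (C : category) (A : C) (c : cond A) (B : C) (a : hom A B)
  {struct c} : Prop :=
  match c with
  | Cond Qforall bs =>
      fold_right (fun br P =>
        match br with
        | existT _ A' (h, c') =>
            (forall g : hom A' B, a = h ;; g -> satisfies c' g) /\ P
        end) True bs
  | Cond Qexists bs =>
      fold_right (fun br P =>
        match br with
        | existT _ A' (h, c') =>
            (exists g : hom A' B, a = h ;; g /\ satisfies c' g) \/ P
        end) False bs
  end.

Lemma satisfies_forall (C : category) (A : C) (S : list (branch A)) (B : C)
    (a : hom A B) :
  satisfies (Cond Qforall S) a <->
  (forall (A' : C) (h : hom A A') (c' : cond A'), In (Branch h c') S ->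
   forall g : hom A' B, a = h ;; g -> satisfies c' g).
Proof.
induction S as [|[A1 [h1 c1]] S IH]; simpl in *.
- split; [intros _ A' h c' [] | auto].
- rewrite IH; split.
  + intros [H1 H2] A' h c' [E|HIn]; [|now eauto].
    change (existT _ A1 (h1, c1)) with (Branch h1 c1) in E.
    pose (P := fun br : branch A => forall g : hom (projT1 br) B,
      a = fst (projT2 br) ;; g -> satisfies (snd (projT2 br)) g).
    assert (HP : P (Branch h1 c1)) by exact H1.
    rewrite E in HP; exact HP.
  + intros H; split; [apply H; now left | intros A' h c' HIn; apply H; now right].
Qed.

Lemma satisfies_exists (C : category) (A : C) (S : list (branch A)) (B : C)
    (a : hom A B) :
  satisfies (Cond Qexists S) a <->
  (exists (A' : C) (h : hom A A') (c' : cond A'), In (Branch h c') S /\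
   exists g : hom A' B, a = h ;; g /\ satisfies c' g).
Proof.
induction S as [|[A1 [h1 c1]] S IH]; simpl in *.
- split; [intros [] | intros (A' & h & c' & [] & _)].
- rewrite IH; split.
  + intros [H|(A' & h & c' & HIn & H)].
    * exists A1, h1, c1; split; [now left | exact H].
    * exists A', h, c'; split; [now right | exact H].
  + intros (A' & h & c' & [E|HIn] & H); [left | right; now eauto].
    change (existT _ A1 (h1, c1)) with (Branch h1 c1) in E.
    pose (P := fun br : branch A => exists g : hom (projT1 br) B,
      a = fst (projT2 br) ;; g /\ satisfies (snd (projT2 br)) g).
    assert (HP : P (Branch h c')) by exact H.
    rewrite <- E in HP; exact HP.
Qed.

Fixpoint shift (C : category) (K : representative_class C) (A : C) (c : cond A)
  (B : C) (f : hom A B) {struct c} : cond B :=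
  match c with
  | Cond q bs =>
      Cond q (flat_map (fun br =>
        match br with
        | existT _ A' (h, c') =>
            map (fun s => Branch (leg2 s) (shift K c' (leg1 s))) (kappa K h f)
        end) bs)
  end.

(* Boolean combinations of conditions over [J], including infinite
   disjunctions, are represented by the arrows that satisfy them. *)
Definition property (C : category) (J : C) := forall K : C, hom J K -> Prop.

Definition sat (C : category) (J : C) (c : cond J) : property J :=
  fun K d => satisfies c d.

Definition and_prop (C : category) (J : C) (P Q : property J) : property J :=
  fun K d => P K d /\ Q K d.

Definition bigor_prop (C : category) (J : C) (I : Type) (P : I -> property J) :
  property J := fun K d => exists i, P i K d.

Definition entails (C : category) (J : C) (P Q : property J) : Prop :=
  forall (K : C) (d : hom J K), P K d -> Q K d.

Record rule (C : category) (O : C) := Rule {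
  interface : C;
  lhs : hom O interface;
  rhs : hom O interface;
  rcond : cond interface
}.

Definition reactive_system (C : category) (O : C) := rule O -> Prop.

Definition context_step (C : category) (K : representative_class C) (O : C)
    (S : reactive_system O) (J : C) (a : hom O J) (L : C) (f : hom J L)
    (A : cond L) (a' : hom O L) : Prop :=
  exists (rho : rule O) (c : hom (interface rho) L),
    S rho /\ a ;; f = lhs rho ;; c /\ a' = rhs rho ;; c /\
    entails (sat A) (sat (shift K (rcond rho) c)).

Definition conditional_relation (C : category) (O : C) :=
  forall J : C, hom O J -> hom O J -> cond J -> Prop.

Definition converse (C : category) (O : C) (R : conditional_relation O) :
  conditional_relation O := fun J a b c => R J b a c.

Inductive contextualization (C : category) (K : representative_class C) (O : C)
    (R : conditional_relation O) : conditional_relation O :=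
  Contextualization (J L : C) (a b : hom O J) (c : cond J) (d : hom J L) :
    R J a b c ->
    contextualization K R (a ;; d) (b ;; d) (shift K c d).

(* In the two simulation conditions below, the family of answering steps is
   indexed by an arbitrary, possibly infinite or empty, type [I]. *)
Definition conditional_simulation (C : category) (K : representative_class C)
    (O : C) (S : reactive_system O) (R : conditional_relation O) : Prop :=
  forall (J : C) (a b : hom O J) (c : cond J), R J a b c ->
  forall (L : C) (f : hom J L) (A : cond L) (a' : hom O L),
    context_step K S a f A a' ->
  exists (I : Type) (B : I -> cond L) (b' : I -> hom O L) (c' : I -> cond L),
    (forall i, context_step K S b f (B i) (b' i)) /\
    (forall i, R L a' (b' i) (c' i)) /\
    entails (and_prop (sat A) (sat (shift K c f)))
            (bigor_prop (fun i => and_prop (sat (c' i)) (sat (B i)))).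

Definition conditional_bisimulation (C : category) (K : representative_class C)
    (O : C) (S : reactive_system O) (R : conditional_relation O) : Prop :=
  conditional_simulation K S R /\ conditional_simulation K S (converse R).

Definition conditional_simulation_upto_context (C : category)
    (K : representative_class C) (O : C) (S : reactive_system O)
    (R : conditional_relation O) : Prop :=
  forall (J : C) (a b : hom O J) (c : cond J), R J a b c ->
  forall (L : C) (f : hom J L) (A : cond L) (a' : hom O L),
    context_step K S a f A a' ->
  exists (I : Type) (B : I -> cond L) (b' : I -> hom O L) (M : I -> C)
    (a'' b'' : forall i, hom O (M i)) (c'' : forall i, cond (M i))
    (j : forall i, hom (M i) L),
    (forall i, context_step K S b f (B i) (b' i)) /\
    (forall i, R (M i) (a'' i) (b'' i) (c'' i)) /\
    (forall i, a' = a'' i ;; j i /\ b' i = b'' i ;; j i) /\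
    entails (and_prop (sat A) (sat (shift K c f)))
            (bigor_prop (fun i => and_prop (sat (shift K (c'' i) (j i))) (sat (B i)))).

Definition conditional_bisimulation_upto_context (C : category)
    (K : representative_class C) (O : C) (S : reactive_system O)
    (R : conditional_relation O) : Prop :=
  conditional_simulation_upto_context K S R /\
  conditional_simulation_upto_context K S (converse R).

(* Main.v *)
(* A context step of [a ;; d] by [f] is the same thing as a context step of [a]
   by [d ;; f], and shifting along [d] and then [f] is semantically the same as
   shifting along [d ;; f]; so the steps of a contextualized pair are answered
   by those of the original pair.  Conversely, [R] embeds into [u(R)] by
   contextualizing with an identity. *)
From Stdlib Require Import List.
Require Import Defs.

(* The automatically generated principle gives no hypothesis for the conditions
   nested in the list of branches. *)
Lemma cond_nested_ind (C : category) (P : forall A : C, cond A -> Prop) :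
  (forall (A : C) q (bs : list (branch A)),
     (forall (A' : C) (h : hom A A') (c' : cond A'),
        In (Branch h c') bs -> P A' c') ->
     P A (Cond q bs)) ->
  forall (A : C) (c : cond A), P A c.
Proof.
intros H; fix IH 2; intros A [q bs].
apply H.
assert (HF : Forall (fun br : branch A => P _ (snd (projT2 br))) bs).
(* The inner [fix] over the list keeps each [c1] visibly a subterm of the condition, so the outer
   recursive call [IH] is guarded. *)
{ revert bs; fix IHbs 1; intros [|[A1 [h1 c1]] bs]; constructor.
  - exact (IH A1 c1).
  - exact (IHbs bs). }
intros A' h c' HIn.
rewrite Forall_forall in HF.
exact (HF _ HIn).
Qed.

(** The list is spelled out as in the body of [shift], so that the lemma applies once that fixpoint
    is unfolded. *)
Lemma in_shift_branches (C : category) (K : representative_class C) (A B : C)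
    (f : hom A B) (bs : list (branch A)) (br : branch B) :
  In br (flat_map (fun br : branch A =>
        match br with
        | existT _ A' (h, c') =>
            map (fun s => Branch (leg2 s) (shift K c' (leg1 s))) (kappa K h f)
        end) bs) <->
  exists (A' : C) (h : hom A A') (c' : cond A') (s : cospan A' B),
    In (Branch h c') bs /\ In s (kappa K h f) /\
    br = Branch (leg2 s) (shift K c' (leg1 s)).
Proof.
rewrite in_flat_map; split.
- intros ([A' [h c']] & Hbs & Hbr).
  apply in_map_iff in Hbr; destruct Hbr as (s & <- & Hs).
  now exists A', h, c', s.
- intros (A' & h & c' & s & Hbs & Hs & ->).
  exists (Branch h c'); split; [exact Hbs|].
  apply in_map_iff; now exists s.
Qed.

(** Squares h;g = f;d factor through a representative square by [kappa_represent], and each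
    representative square yields such a square by [kappa_commute]. The induction is generalized over
    [f] and [d], since a branch condition is shifted along [leg1 s] instead of [f]. *)
Lemma satisfies_shift (C : category) (K : representative_class C) (A : C)
    (c : cond A) (B : C) (f : hom A B) (D : C) (d : hom B D) :
  satisfies (shift K c f) d <-> satisfies c (f ;; d).
Proof.
revert A c B f D d.
apply (cond_nested_ind C (fun A c => forall B (f : hom A B) D (d : hom B D),
  satisfies (shift K c f) d <-> satisfies c (f ;; d))).
intros A [] bs IH B f D d; cbn [shift].
- rewrite !satisfies_forall; split.
  + intros H A' h c' Hbs g E.
    destruct (kappa_represent K (eq_sym E)) as (s & Hs & g' & -> & Ed).
    apply (IH _ _ _ Hbs).
    apply (H _ (leg2 s) (shift K c' (leg1 s))); [|exact Ed].
    apply in_shift_branches; now exists A', h, c', s.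
  + intros H A'' h'' c'' Hbr.
    apply in_shift_branches in Hbr.
    destruct Hbr as (A' & h & c' & s & Hbs & Hs & E).
    (* Stated through projections, the goal can be rewritten with the equation [E] between dependent
       pairs; no injectivity of [existT] is needed. *)
    change (forall g, d = fst (projT2 (Branch h'' c'')) ;; g ->
      satisfies (snd (projT2 (Branch h'' c''))) g).
    rewrite E; simpl; intros g ->.
    apply (IH _ _ _ Hbs), (H _ _ _ Hbs).
    now rewrite <- !compA, (kappa_commute Hs).
- rewrite !satisfies_exists; split.
  + intros (A'' & h'' & c'' & Hbr & Hg).
    apply in_shift_branches in Hbr.
    destruct Hbr as (A' & h & c' & s & Hbs & Hs & E).
    change (exists g, d = fst (projT2 (Branch h'' c'')) ;; g /\
      satisfies (snd (projT2 (Branch h'' c''))) g) in Hg.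
    rewrite E in Hg; simpl in Hg; destruct Hg as (g & -> & Hg).
    exists A', h, c'; split; [exact Hbs|].
    exists (leg1 s ;; g); split.
    * now rewrite <- !compA, (kappa_commute Hs).
    * now apply (IH _ _ _ Hbs).
  + intros (A' & h & c' & Hbs & g & E & Hg).
    destruct (kappa_represent K (eq_sym E)) as (s & Hs & g' & -> & Ed).
    exists _, (leg2 s), (shift K c' (leg1 s)); split.
    * apply in_shift_branches; now exists A', h, c', s.
    * exists g'; split; [exact Ed|]; now apply (IH _ _ _ Hbs).
Qed.

Lemma context_step_comp (C : category) (K : representative_class C) (O : C)
    (S : reactive_system O) (J M L : C) (a : hom O J) (d : hom J M)
    (f : hom M L) (A : cond L) (a' : hom O L) :
  context_step K S (a ;; d) f A a' <-> context_step K S a (d ;; f) A a'.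
Proof. unfold context_step; now rewrite compA. Qed.

(** Equations in place of indices allow case analysis when [x], [y] and [e] are not variables. *)
Lemma contextualization_inv (C : category) (K : representative_class C) (O : C)
    (R : conditional_relation O) (L : C) (x y : hom O L) (e : cond L) :
  contextualization K R x y e ->
  exists (J : C) (a b : hom O J) (c : cond J) (d : hom J L),
    R J a b c /\ x = a ;; d /\ y = b ;; d /\ e = shift K c d.
Proof. intros [J L' a b c d H]; now exists J, a, b, c, d. Qed.

(* The up-to condition asks for functions choosing a decomposition of each
   answer, whereas membership in [u(R)] only asserts that one exists.  Indexing
   the answers by all their decompositions avoids the axiom of choice. *)
Record decomposition (C : category) (K : representative_class C) (O : C)
    (R : conditional_relation O) (L : C) (x y : hom O L) (e : cond L) :=
  Decomposition {
    dec_obj : C;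
    dec_left : hom O dec_obj;
    dec_right : hom O dec_obj;
    dec_cond : cond dec_obj;
    dec_context : hom dec_obj L;
    dec_rel : R dec_obj dec_left dec_right dec_cond;
    dec_left_eq : x = dec_left ;; dec_context;
    dec_right_eq : y = dec_right ;; dec_context;
    dec_cond_eq : e = shift K dec_cond dec_context
  }.

Arguments dec_obj {C K O R L x y e}.
Arguments dec_left {C K O R L x y e}.
Arguments dec_right {C K O R L x y e}.
Arguments dec_cond {C K O R L x y e}.
Arguments dec_context {C K O R L x y e}.
Arguments dec_rel {C K O R L x y e}.
Arguments dec_left_eq {C K O R L x y e}.
Arguments dec_right_eq {C K O R L x y e}.
Arguments dec_cond_eq {C K O R L x y e}.

(** Only one direction of the game is treated, for arbitrary [R], so that the result also applies to
    [converse R]. *)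
Lemma simulation_upto_context_iff (C : category) (K : representative_class C)
    (O : C) (S : reactive_system O) (R : conditional_relation O) :
  conditional_simulation_upto_context K S R <->
  conditional_simulation K S (contextualization K R).
Proof.
split.
- intros H M x y e Hu L f A a' Hstep.
  destruct (contextualization_inv _ _ _ _ _ _ _ _ Hu)
    as (J & a & b & c & d & HR & -> & -> & ->).
  apply context_step_comp in Hstep.
  destruct (H J a b c HR L (d ;; f) A a' Hstep)
    as (I & B & b' & N & a'' & b'' & c'' & j & HB & HR' & Hab & Hent).
  (* Shifting each condition along its own context [j i] puts the answering triple into the
     contextualization. *)
  exists I, B, b', (fun i => shift K (c'' i) (j i)).
  split; [|split].
  + intros i; apply context_step_comp, HB.
  + intros i; destruct (Hab i) as [-> ->]; now constructor.
  + intros D g [HA Hc]; apply Hent; split; [exact HA|].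
    (* Both shifted conditions say that [c] is satisfied by the composite of [d], [f] and [g]. *)
    unfold sat in *; rewrite !satisfies_shift in *; now rewrite compA.
- intros H J a b c HR L f A a' Hstep.
  assert (Hid : context_step K S (a ;; idc J) f A a')
    by now apply context_step_comp; rewrite comp1f.
  destruct (H J _ _ _ (Contextualization K (idc J) HR) L f A a' Hid)
    as (I & B & b' & c' & HB & HR' & Hent).
  pose (T := {i : I & decomposition C K O R L a' (b' i) (c' i)}).
  exists T,
    (fun k : T => B (projT1 k)), (fun k : T => b' (projT1 k)),
    (fun k : T => dec_obj (projT2 k)), (fun k : T => dec_left (projT2 k)),
    (fun k : T => dec_right (projT2 k)), (fun k : T => dec_cond (projT2 k)),
    (fun k : T => dec_context (projT2 k)).
  split; [|split; [|split]].
  + intros [i w]; simpl.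
    rewrite <- (comp1f f); apply context_step_comp, HB.
  + intros [i w]; exact (dec_rel w).
  + intros [i w]; exact (conj (dec_left_eq w) (dec_right_eq w)).
  + intros D g [HA Hc].
    destruct (Hent D g) as (i & Hc' & HBi).
    { split; [exact HA|].
      unfold sat in *; rewrite !satisfies_shift in *; now rewrite comp1f. }
    (* The goal is a proposition here, so the mere existence of a decomposition suffices to produce
       an index in [T]. *)
    destruct (contextualization_inv _ _ _ _ _ _ _ _ (HR' i))
      as (M & a'' & b'' & c'' & j & HR'' & Ea & Eb & Ec).
    exists (existT _ i
      (Decomposition C K O R L _ _ _ M a'' b'' c'' j HR'' Ea Eb Ec)); simpl.
    rewrite <- Ec; now split.
Qed.

(** Pointwise equivalent relations need not be equal as functions, so the simulation property is
    transported explicitly. *)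
Lemma conditional_simulation_ext (C : category) (K : representative_class C)
    (O : C) (S : reactive_system O) (R R' : conditional_relation O) :
  (forall (J : C) (a b : hom O J) (c : cond J), R J a b c <-> R' J a b c) ->
  conditional_simulation K S R -> conditional_simulation K S R'.
Proof.
intros HRR H J a b c HR L f A a' Hstep.
apply HRR in HR.
destruct (H J a b c HR L f A a' Hstep) as (I & B & b' & c' & HB & HR' & Hent).
exists I, B, b', c'; split; [exact HB|split; [|exact Hent]].
intros i; apply HRR, HR'.
Qed.

(** Both components are extended by the same context [d], so swapping them before or after makes no
    difference. *)
Lemma contextualization_converse (C : category) (K : representative_class C)
    (O : C) (R : conditional_relation O) (J : C) (a b : hom O J) (c : cond J) :
  contextualization K (converse R) a b c <->
  converse (contextualization K R) (J := J) a b c.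
Proof.
split.
- intros [J' L a' b' c' d H]; now apply Contextualization.
- intros H; unfold converse in H.
  destruct H; now apply (@Contextualization C K O (converse R)).
Qed.

Theorem theorem5p10 (C : category) (K : representative_class C) (O : C)
    (S : reactive_system O) (R : conditional_relation O) :
  conditional_bisimulation_upto_context K S R <->
  conditional_bisimulation K S (contextualization K R).
Proof.
unfold conditional_bisimulation_upto_context, conditional_bisimulation.
rewrite !simulation_upto_context_iff.
(* The first halves now agree; the second halves differ only in the order of [converse] and
   [contextualization]. *)
split; intros [H1 H2]; split; try exact H1;
  revert H2; apply conditional_simulation_ext; intros J a b c.
- apply contextualization_converse.
- symmetry; apply contextualization_converse.
Qed.
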